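(* For all processes $P,Q\in\mathcal P$: $P\sqsupseteq_{1}Q$ if and only if $P\sqsupseteq_{2}Q$; i.e. the strong 1-faster-than and strong 2-faster-than precongruences coincide.
   Context: TACS. Fix a countable set $\Lambda$ of action names; $\overline{\Lambda}=\{\overline a : a\in\Lambda\}$ with $\overline{\overline a}=a$; $\mathcal A=\Lambda\cup\overline\Lambda\cup\{\tau\}$ is the set of actions (ranged over by $\alpha$), and $a$ ranges over $\Lambda\cup\overline\Lambda$. Terms (set $\widehat{\mathcal P}$) are generated by $P::=\mathbf 0\mid x\mid \alpha.P\mid \sigma.P\mid P+P\mid P|P\mid P\backslash L\mid P[f]\mid \mu x.P$, where $x$ ranges over a countably infinite set of variables, $L\subseteq\mathcal A\setminus\{\tau\}$ is finite, and $f:\mathcal A\to\mathcal A$ satisfies $f(\tau)=\tau$, $f(\overline a)=\overline{f(a)}$ and $f(\alpha)\neq\alpha$ for only finitely many $\alpha$. $\mu x$ binds $x$; $P[Q/x]$ denotes substitution of $Q$ for the free occurrences of $x$. A variable is guarded in a term if each of its occurrences is in the scope of an action prefix $\alpha.\_$ (a $\sigma$-prefix does not count). In every term $\mu x.P$, $x$ must be guarded in $P$. Processes (set $\mathcal P$) are the closed terms. $\overline L=\{\overline a: a\in L\}$. Urgent sets: $\mathcal U(\sigma.P)=\mathcal U(\mathbf 0)=\mathcal U(x)=\emptyset$, $\mathcal U(\alpha.P)=\{\alpha\}$, $\mathcal U(P+Q)=\mathcal U(P)\cup\mathcal U(Q)$, $\mathcal U(P|Q)=\mathcal U(P)\cup\mathcal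 U(Q)\cup\{\tau\mid \mathcal U(P)\cap\overline{\mathcal U(Q)}\neq\emptyset\}$, $\mathcal U(P\backslash L)=\mathcal U(P)\setminus(L\cup\overline L)$, $\mathcal U(P[f])=\{f(\alpha):\alpha\in\mathcal U(P)\}$, $\mathcal U(\mu x.P)=\mathcal U(P)$. Action transitions $\xrightarrow{\alpha}$ are the least relations with: $\alpha.P\xrightarrow{\alpha}P$; if $P\xrightarrow{\alpha}P'$ then $\sigma.P\xrightarrow{\alpha}P'$, $\mu x.P\xrightarrow{\alpha}P'[\mu x.P/x]$, $P+Q\xrightarrow{\alpha}P'$, $Q+P\xrightarrow{\alpha}P'$, $P|Q\xrightarrow{\alpha}P'|Q$, $Q|P\xrightarrow{\alpha}Q|P'$, $P[f]\xrightarrow{f(\alpha)}P'[f]$, and $P\backslash L\xrightarrow{\alpha}P'\backslash L$ if $\alpha\notin L\cup\overline L$; if $P\xrightarrow{a}P'$ and $Q\xrightarrow{\overline a}Q'$ then $P|Q\xrightarrow{\tau}P'|Q'$. Clock transitions $\xrightarrow{\sigma}_i$ ($i\in\{1,2\}$) are the least relations with: $\mathbf 0\xrightarrow{\sigma}_i\mathbf 0$; $a.P\xrightarrow{\sigma}_i a.P$ for $a\in\Lambda\cup\overline\Lambda$; $\sigma.P\xrightarrow{\sigma}_iP$; if $P\xrightarrow{\sigma}_iP'$ then $\mu x.P\xrightarrow{\sigma}_iP'[\mu x.P/x]$, $P\backslash L\xrightarrow{\sigma}_iP'\backslash L$, $P[f]\xrightarrow{\sigma}_iP'[f]$; if $P\xrightarrow{\sigma}_iP'$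 and $Q\xrightarrow{\sigma}_iQ'$ then $P+Q\xrightarrow{\sigma}_iP'+Q'$, and $P|Q\xrightarrow{\sigma}_iP'|Q'$ provided $\tau\notin\mathcal U(P|Q)$; and, only for $i=2$: if $P\xrightarrow{\sigma}_2P'$ then $\sigma.P\xrightarrow{\sigma}_2P'$. For $i\in\{1,2\}$, $\mathcal R\subseteq\mathcal P\times\mathcal P$ is a strong i-faster-than relation if for all $(P,Q)\in\mathcal R$, $\alpha\in\mathcal A$: (1) $P\xrightarrow{\alpha}P'$ implies $\exists Q'$. $Q\xrightarrow{\alpha}Q'$, $(P',Q')\in\mathcal R$; (2) $Q\xrightarrow{\alpha}Q'$ implies $\exists P'$. $P\xrightarrow{\alpha}P'$, $(P',Q')\in\mathcal R$; (3) $P\xrightarrow{\sigma}_iP'$ implies $\mathcal U(Q)\subseteq\mathcal U(P)$ and $\exists Q'$. $Q\xrightarrow{\sigma}_iQ'$, $(P',Q')\in\mathcal R$. $P\sqsupseteq_iQ$ iff $(P,Q)$ lies in some strong i-faster-than relation. *)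

(* Defs.v *)
From mathcomp Require Export all_boot finmap.

Set Implicit Arguments.
Unset Strict Implicit.
Unset Printing Implicit Defensive.

Local Open Scope fset_scope.

(* Action names range over an arbitrary countable type [Lam].                 *)
(* [(a, false)] is the name [a] and [(a, true)] its complement, so that names *)
(* and co-names are disjoint.  The internal action tau is [None].             *)
Definition label (Lam : countType) : Type := (Lam * bool)%type.

Definition act (Lam : countType) : Type := option (label Lam).

Definition tau {Lam : countType} : act Lam := None.
Definition vis (Lam : countType) (a : label Lam) : act Lam := Some a.

Definition co (Lam : countType) (a : label Lam) : label Lam := (a.1, ~~ a.2).

(* Complementation is only meaningful on visible actions.  Hence the law      *)
(* f(co a) = co (f a) forces f(a) to be visible.                              *)
Record relabelling (Lam : countType) : Type := Relabelling {
  relab :> act Lam -> act Lam;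
  relab_tau : relab tau = tau;
  relab_co : forall a : label Lam,
    exists2 b : label Lam,
      relab (vis a) = vis b & relab (vis (co a)) = vis (co b);
  relab_finite : exists S : {fset act Lam},
    forall alpha : act Lam, relab alpha != alpha -> alpha \in S
}.

(* Terms modulo alpha-conversion, with de Bruijn indices: [Mu] binds index 0  *)
(* of its body.                                                               *)
Inductive term (Lam : countType) : Type :=
| Nil
| Var of nat
| Pre of act Lam & term Lam
| Clk of term Lam
| Sum of term Lam & term Lam
| Par of term Lam & term Lam
| Res of term Lam & {fset label Lam}
| Rel of term Lam & relabelling Lam
| Mu of term Lam.

Arguments Nil {Lam}.
Arguments Var {Lam} _.

Definition up_ren (xi : nat -> nat) (n : nat) : nat :=
  if n is m.+1 then (xi m).+1 else 0.

Fixpoint rename (Lam : countType) (xi : nat -> nat) (P : term Lam) : term Lam :=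
  match P with
  | Nil => Nil
  | Var n => Var (xi n)
  | Pre alpha P => Pre alpha (rename xi P)
  | Clk P => Clk (rename xi P)
  | Sum P Q => Sum (rename xi P) (rename xi Q)
  | Par P Q => Par (rename xi P) (rename xi Q)
  | Res P L => Res (rename xi P) L
  | Rel P f => Rel (rename xi P) f
  | Mu P => Mu (rename (up_ren xi) P)
  end.

Definition up (Lam : countType) (s : nat -> term Lam) (n : nat) : term Lam :=
  if n is m.+1 then rename succn (s m) else Var 0.

(* Capture-avoiding parallel substitution.                                    *)
Fixpoint subst (Lam : countType) (s : nat -> term Lam) (P : term Lam) :
    term Lam :=
  match P with
  | Nil => Nil
  | Var n => s n
  | Pre alpha P => Pre alpha (subst s P)
  | Clk P => Clk (subst s P)
  | Sum P Q => Sum (subst s P) (subst s Q)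
  | Par P Q => Par (subst s P) (subst s Q)
  | Res P L => Res (subst s P) L
  | Rel P f => Rel (subst s P) f
  | Mu P => Mu (subst (up s) P)
  end.

(* [inst P Q] is P[Q/x] for x the variable of index 0 in P; the other free    *)
(* indices of P are lowered, since the binder of x disappears.                *)
Definition inst (Lam : countType) (P Q : term Lam) : term Lam :=
  subst (fun n => if n is m.+1 then Var m else Q) P.

Fixpoint guarded (Lam : countType) (x : nat) (P : term Lam) : bool :=
  match P with
  | Nil => true
  | Var y => y != x
  | Pre _ _ => true
  | Clk P => guarded x P
  | Sum P Q => guarded x P && guarded x Q
  | Par P Q => guarded x P && guarded x Q
  | Res P _ => guarded x P
  | Rel P _ => guarded x P
  | Mu P => guarded x.+1 P
  end.

(* Every recursion binds a guarded variable.                                  *)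
Fixpoint well_guarded (Lam : countType) (P : term Lam) : bool :=
  match P with
  | Nil => true
  | Var _ => true
  | Pre _ P => well_guarded P
  | Clk P => well_guarded P
  | Sum P Q => well_guarded P && well_guarded Q
  | Par P Q => well_guarded P && well_guarded Q
  | Res P _ => well_guarded P
  | Rel P _ => well_guarded P
  | Mu P => guarded 0 P && well_guarded P
  end.

(* All free indices of P are below k.                                         *)
Fixpoint closed_at (Lam : countType) (k : nat) (P : term Lam) : bool :=
  match P with
  | Nil => true
  | Var y => y < k
  | Pre _ P => closed_at k P
  | Clk P => closed_at k P
  | Sum P Q => closed_at k P && closed_at k Q
  | Par P Q => closed_at k P && closed_at k Q
  | Res P _ => closed_at k P
  | Rel P _ => closed_at k P
  | Mu P => closed_at k.+1 P
  end.

Definition process (Lam : countType) (P : term Lam) : bool :=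
  well_guarded P && closed_at 0 P.

Definition restricted (Lam : countType) (L : {fset label Lam}) :
    {fset act Lam} :=
  [fset vis a | a in L `|` [fset co b | b in L]].

(* The complements of the visible members of U: tau has no complement, so it  *)
(* contributes nothing.                                                       *)
Definition co_set (Lam : countType) (U : {fset act Lam}) : {fset act Lam} :=
  [fset vis (co a) | a in pmap id U].

Fixpoint urgent (Lam : countType) (P : term Lam) : {fset act Lam} :=
  match P with
  | Nil => fset0
  | Var _ => fset0
  | Pre alpha _ => [fset alpha]
  | Clk _ => fset0
  | Sum P Q => urgent P `|` urgent Q
  | Par P Q => urgent P `|` urgent Q `|`
      (if urgent P `&` co_set (urgent Q) != fset0 then [fset tau] else fset0)
  | Res P L => urgent P `\` restricted L
  | Rel P f => [fset relab f alpha | alpha in urgent P]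
  | Mu P => urgent P
  end.

Inductive step (Lam : countType) : term Lam -> act Lam -> term Lam -> Prop :=
| step_pre alpha P : step (Pre alpha P) alpha P
| step_clk alpha P P' : step P alpha P' -> step (Clk P) alpha P'
| step_mu alpha P P' : step P alpha P' -> step (Mu P) alpha (inst P' (Mu P))
| step_suml alpha P Q P' : step P alpha P' -> step (Sum P Q) alpha P'
| step_sumr alpha P Q P' : step P alpha P' -> step (Sum Q P) alpha P'
| step_parl alpha P Q P' : step P alpha P' -> step (Par P Q) alpha (Par P' Q)
| step_parr alpha P Q P' : step P alpha P' -> step (Par Q P) alpha (Par Q P')
| step_rel alpha P P' (f : relabelling Lam) :
    step P alpha P' -> step (Rel P f) (f alpha) (Rel P' f)
| step_res alpha P P' L :
    alpha \notin restricted L -> step P alpha P' ->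
    step (Res P L) alpha (Res P' L)
| step_com a P P' Q Q' :
    step P (vis a) P' -> step Q (vis (co a)) Q' ->
    step (Par P Q) tau (Par P' Q').

Variant clock_type : Set := type1 | type2.

Inductive tick (Lam : countType) (i : clock_type) :
    term Lam -> term Lam -> Prop :=
| tick_nil : tick i Nil Nil
| tick_pre a P : tick i (Pre (vis a) P) (Pre (vis a) P)
| tick_clk P : tick i (Clk P) P
| tick_mu P P' : tick i P P' -> tick i (Mu P) (inst P' (Mu P))
| tick_res P P' L : tick i P P' -> tick i (Res P L) (Res P' L)
| tick_rel P P' f : tick i P P' -> tick i (Rel P f) (Rel P' f)
| tick_sum P P' Q Q' :
    tick i P P' -> tick i Q Q' -> tick i (Sum P Q) (Sum P' Q')
| tick_par P P' Q Q' :
    tick i P P' -> tick i Q Q' -> tau \notin urgent (Par P Q) ->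
    tick i (Par P Q) (Par P' Q')
| tick_skip P P' : i = type2 -> tick i P P' -> tick i (Clk P) P'.

Definition faster_than_relation (Lam : countType) (i : clock_type)
    (R : term Lam -> term Lam -> Prop) : Prop :=
  (forall P Q, R P Q -> process P /\ process Q) /\
  (forall P Q, R P Q ->
   [/\ forall alpha P', step P alpha P' -> exists2 Q', step Q alpha Q' & R P' Q',
       forall alpha Q', step Q alpha Q' -> exists2 P', step P alpha P' & R P' Q'
     & forall P', tick i P P' ->
         urgent Q `<=` urgent P /\ exists2 Q', tick i Q Q' & R P' Q']).

Definition faster_than (Lam : countType) (i : clock_type) (P Q : term Lam) :
    Prop :=
  exists2 R : term Lam -> term Lam -> Prop, faster_than_relation i R & R P Q.

(* Main.v *)
Require Import Defs.

Set Implicit Arguments.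
Unset Strict Implicit.
Unset Printing Implicit Defensive.

Local Open Scope fset_scope.

(** A type-1 clock step removes the outermost leading clock prefixes, while a
    type-2 step may remove further ones.  Say that P is ahead of Q if P arises
    from Q by removing leading clock prefixes.  Being ahead implies being
    i-faster for both i: action steps ignore leading clock prefixes, urgent
    sets only grow, and every clock step leads to a term that is ahead of its
    source.  As the type-1 clock step of a term is its least advanced type-2
    clock step, transitivity of the faster-than preorders converts each
    simulation condition into the other one. *)

(** * Renaming, substitution and their effect on guardedness and closedness *)

Section Substitution.
Variable Lam : countType.
Implicit Types (P Q : term Lam) (s t : nat -> term Lam) (xi zeta : nat -> nat).

Lemma rename_ext P xi zeta : xi =1 zeta -> rename xi P = rename zeta P.
Proof.
elim: P xi zeta => //=.
- by move=> n xi zeta ->.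
- by move=> a P IH xi zeta /IH ->.
- by move=> P IH xi zeta /IH ->.
- by move=> P IHP Q IHQ xi zeta e; rewrite (IHP _ _ e) (IHQ _ _ e).
- by move=> P IHP Q IHQ xi zeta e; rewrite (IHP _ _ e) (IHQ _ _ e).
- by move=> P IH L xi zeta /IH ->.
- by move=> P IH f xi zeta /IH ->.
- by move=> P IH xi zeta e; congr Mu; apply: IH => -[|n] //=; rewrite e.
Qed.

Lemma subst_ext P s t : s =1 t -> subst s P = subst t P.
Proof.
elim: P s t => //=.
- by move=> a P IH s t /IH ->.
- by move=> P IH s t /IH ->.
- by move=> P IHP Q IHQ s t e; rewrite (IHP _ _ e) (IHQ _ _ e).
- by move=> P IHP Q IHQ s t e; rewrite (IHP _ _ e) (IHQ _ _ e).
- by move=> P IH L s t /IH ->.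
- by move=> P IH f s t /IH ->.
- by move=> P IH s t e; congr Mu; apply: IH => -[|n] //=; rewrite e.
Qed.

Lemma rename_comp P xi zeta :
  rename xi (rename zeta P) = rename (xi \o zeta) P.
Proof.
elim: P xi zeta => //=; try by move=> *; congruence.
by move=> P IH xi zeta; rewrite IH; congr Mu; apply: rename_ext => -[].
Qed.

Lemma subst_rename P s xi : subst s (rename xi P) = subst (s \o xi) P.
Proof.
elim: P s xi => //=; try by move=> *; congruence.
by move=> P IH s xi; rewrite IH; congr Mu; apply: subst_ext => -[].
Qed.

Lemma rename_subst P s xi :
  rename xi (subst s P) = subst (rename xi \o s) P.
Proof.
elim: P s xi => //=; try by move=> *; congruence.
move=> P IH s xi; rewrite IH; congr Mu; apply: subst_ext => -[|n] //=.
by rewrite !rename_comp; apply: rename_ext.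
Qed.

Lemma subst_comp P s t : subst s (subst t P) = subst (subst s \o t) P.
Proof.
elim: P s t => //=; try by move=> *; congruence.
move=> P IH s t; rewrite IH; congr Mu; apply: subst_ext => -[|n] //=.
by rewrite subst_rename rename_subst; apply: subst_ext.
Qed.

Lemma subst_Var P s : s =1 Var -> subst s P = P.
Proof.
elim: P s => //=.
- by move=> a P IH s /IH ->.
- by move=> P IH s /IH ->.
- by move=> P IHP Q IHQ s e; rewrite (IHP _ e) (IHQ _ e).
- by move=> P IHP Q IHQ s e; rewrite (IHP _ e) (IHQ _ e).
- by move=> P IH L s /IH ->.
- by move=> P IH f s /IH ->.
- by move=> P IH s e; rewrite IH // => -[|n] //=; rewrite e.
Qed.

Lemma subst_inst P Q s :
  subst s (inst P Q) = inst (subst (up s) P) (subst s Q).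
Proof.
rewrite /inst !subst_comp; apply: subst_ext => -[|n] //=.
(* At index [n.+1] the lowering done by [inst] cancels the shift done by [up s], which leaves
   [s n]. *)
by rewrite subst_rename subst_Var.
Qed.

(** The disjunction is taken index by index, so it splits over binary operators and survives [Mu]:
    the new index 0 is sent to 0, which differs from [y.+1]. *)
Lemma guarded_rename P xi y :
  (forall x, guarded x P \/ xi x != y) -> guarded y (rename xi P).
Proof.
elim: P xi y => //=.
- by move=> n xi y /(_ n) [] //; rewrite eqxx.
- move=> P IHP Q IHQ xi y h; apply/andP; split.
    by apply: IHP => x; case: (h x) => [/andP[]|]; auto.
  by apply: IHQ => x; case: (h x) => [/andP[]|]; auto.
- move=> P IHP Q IHQ xi y h; apply/andP; split.
    by apply: IHP => x; case: (h x) => [/andP[]|]; auto.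
  by apply: IHQ => x; case: (h x) => [/andP[]|]; auto.
- by move=> P IH xi y h; apply: IH => -[|n] /=; [right|apply: h].
Qed.

Lemma guarded_subst P s y :
  (forall x, guarded x P \/ guarded y (s x)) -> guarded y (subst s P).
Proof.
elim: P s y => //=.
- by move=> n s y /(_ n) [] //; rewrite eqxx.
- move=> P IHP Q IHQ s y h; apply/andP; split.
    by apply: IHP => x; case: (h x) => [/andP[]|]; auto.
  by apply: IHQ => x; case: (h x) => [/andP[]|]; auto.
- move=> P IHP Q IHQ s y h; apply/andP; split.
    by apply: IHP => x; case: (h x) => [/andP[]|]; auto.
  by apply: IHQ => x; case: (h x) => [/andP[]|]; auto.
- move=> P IH s y h; apply: IH => -[|n] /=; first by right.
  case: (h n) => [|g]; first by left.
  right; apply: guarded_rename => x.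
  by case: (eqVneq x y) => [->|]; [left|right].
Qed.

(** Apart from index 0 itself, [up s] yields only shifted terms, in which index 0 cannot occur.
    Hence substitution under a binder keeps the recursion guarded. *)
Lemma guarded0_up P s : guarded 0 P -> guarded 0 (subst (up s) P).
Proof.
move=> g; apply: guarded_subst => -[|n] /=; first by left.
by right; apply: guarded_rename => x; right.
Qed.

Lemma well_guarded_rename P xi : well_guarded P -> well_guarded (rename xi P).
Proof.
elim: P xi => //=.
- by move=> P IHP Q IHQ xi /andP[/IHP -> /IHQ ->].
- by move=> P IHP Q IHQ xi /andP[/IHP -> /IHQ ->].
- move=> P IH xi /andP[g /IH ->]; rewrite andbT.
  by apply: guarded_rename => -[|n] /=; [left|right].
Qed.

Lemma well_guarded_subst P s :
  well_guarded P -> (forall x, well_guarded (s x)) -> well_guarded (subst s P).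
Proof.
elim: P s => //=.
- by move=> P IHP Q IHQ s /andP[wP wQ] ws; rewrite IHP ?IHQ.
- by move=> P IHP Q IHQ s /andP[wP wQ] ws; rewrite IHP ?IHQ.
- move=> P IH s /andP[gP wP] ws; rewrite guarded0_up //=.
  by apply: IH => // -[|n] //=; apply: well_guarded_rename.
Qed.

Lemma closed_at_rename P xi k m :
  closed_at k P -> (forall x, x < k -> xi x < m) -> closed_at m (rename xi P).
Proof.
elim: P xi k m => //=.
- by move=> n xi k m nk; apply.
- by move=> P IHP Q IHQ xi k m /andP[cP cQ] h; rewrite (IHP _ k) ?(IHQ _ k).
- by move=> P IHP Q IHQ xi k m /andP[cP cQ] h; rewrite (IHP _ k) ?(IHQ _ k).
- by move=> P IH xi k m cP h; apply: (IH _ k.+1) => // -[|n] //= /h.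
Qed.

Lemma closed_at_subst P s k m :
  closed_at k P -> (forall x, x < k -> closed_at m (s x)) ->
  closed_at m (subst s P).
Proof.
elim: P s k m => //=.
- by move=> n s k m nk; apply.
- by move=> P IHP Q IHQ s k m /andP[cP cQ] h; rewrite (IHP _ k) ?(IHQ _ k).
- by move=> P IHP Q IHQ s k m /andP[cP cQ] h; rewrite (IHP _ k) ?(IHQ _ k).
- move=> P IH s k m cP h; apply: (IH _ k.+1) => // -[|n] //= /h c.
  exact: closed_at_rename c _.
Qed.

Lemma well_guarded_inst P Q :
  well_guarded P -> well_guarded Q -> well_guarded (inst P Q).
Proof. by move=> wP wQ; apply: well_guarded_subst => // -[]. Qed.

Lemma closed_at_inst P Q k :
  closed_at k.+1 P -> closed_at k Q -> closed_at k (inst P Q).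
Proof. by move=> cP cQ; apply: closed_at_subst cP _ => -[]. Qed.

End Substitution.

(** * Inversion of transitions and preservation of well-formedness *)

Section Transitions.
Variable Lam : countType.
Implicit Types (P Q : term Lam) (s : nat -> term Lam) (alpha : act Lam).

Lemma step_sum_inv P Q alpha T :
  step (Sum P Q) alpha T -> step P alpha T \/ step Q alpha T.
Proof. by move=> st; inversion st; auto. Qed.

Lemma step_par_inv P Q alpha T :
  step (Par P Q) alpha T ->
  [\/ exists2 P', T = Par P' Q & step P alpha P',
      exists2 Q', T = Par P Q' & step Q alpha Q'
    | exists a P' Q', [/\ alpha = tau, T = Par P' Q', step P (vis a) P'
        & step Q (vis (co a)) Q']].
Proof.
move=> st; inversion st as [| | | | |? ? ? P'|? ? ? Q'| | |a ? P' ? Q']; subst.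
- by apply: Or31; exists P'.
- by apply: Or32; exists Q'.
- by apply: Or33; exists a, P', Q'.
Qed.

Lemma step_res_inv P L alpha T :
  step (Res P L) alpha T ->
  alpha \notin restricted L /\ exists2 P', T = Res P' L & step P alpha P'.
Proof. by move=> st; inversion st; split=> //; eexists. Qed.

Lemma step_rel_inv P (f : relabelling Lam) alpha T :
  step (Rel P f) alpha T ->
  exists beta P', [/\ alpha = f beta, T = Rel P' f & step P beta P'].
Proof. by move=> st; inversion st; do 2 eexists. Qed.

Lemma step_mu_inv P alpha T :
  step (Mu P) alpha T -> exists2 P', T = inst P' (Mu P) & step P alpha P'.
Proof. by move=> st; inversion st; eexists. Qed.

Lemma tick_sum_inv i P Q T :
  tick i (Sum P Q) T ->
  exists P' Q', [/\ T = Sum P' Q', tick i P P' & tick i Q Q'].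
Proof. by move=> st; inversion st; do 2 eexists. Qed.

Lemma tick_par_inv i P Q T :
  tick i (Par P Q) T ->
  exists P' Q', [/\ T = Par P' Q', tick i P P', tick i Q Q'
    & tau \notin urgent (Par P Q)].
Proof. by move=> st; inversion st; do 2 eexists. Qed.

Lemma tick_res_inv i P L T :
  tick i (Res P L) T -> exists2 P', T = Res P' L & tick i P P'.
Proof. by move=> st; inversion st; eexists. Qed.

Lemma tick_rel_inv i P (f : relabelling Lam) T :
  tick i (Rel P f) T -> exists2 P', T = Rel P' f & tick i P P'.
Proof. by move=> st; inversion st; eexists. Qed.

Lemma tick_mu_inv i P T :
  tick i (Mu P) T -> exists2 P', T = inst P' (Mu P) & tick i P P'.
Proof. by move=> st; inversion st; eexists. Qed.

Lemma step_well_guarded P alpha P' :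
  step P alpha P' -> well_guarded P -> well_guarded P'.
Proof.
elim=> {P alpha P'} //=.
- move=> alpha P P' _ IH /andP[gP wP].
  by apply: well_guarded_inst; rewrite /= ?gP ?IH.
- by move=> alpha P Q P' _ IH /andP[/IH].
- by move=> alpha P Q P' _ IH /andP[_ /IH].
- by move=> alpha P Q P' _ IH /andP[/IH -> ->].
- by move=> alpha P Q P' _ IH /andP[-> /IH ->].
- by move=> a P P' Q Q' _ IHP _ IHQ /andP[/IHP -> /IHQ ->].
Qed.

Lemma step_closed_at P alpha P' k :
  step P alpha P' -> closed_at k P -> closed_at k P'.
Proof.
move=> st; elim: st k => {P alpha P'} //=.
- by move=> alpha P P' _ IH k cP; apply: closed_at_inst => //; apply: IH.
- by move=> alpha P Q P' _ IH k /andP[/IH].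
- by move=> alpha P Q P' _ IH k /andP[_ /IH].
- by move=> alpha P Q P' _ IH k /andP[/IH -> ->].
- by move=> alpha P Q P' _ IH k /andP[-> /IH ->].
- by move=> a P P' Q Q' _ IHP _ IHQ k /andP[/IHP -> /IHQ ->].
Qed.

Lemma step_process P alpha P' : step P alpha P' -> process P -> process P'.
Proof.
move=> st /andP[wP cP].
by rewrite /process (step_well_guarded st) ?(step_closed_at st).
Qed.

Lemma tick_well_guarded i P P' :
  tick i P P' -> well_guarded P -> well_guarded P'.
Proof.
elim=> {P P'} //=.
- move=> P P' _ IH /andP[gP wP].
  by apply: well_guarded_inst; rewrite /= ?gP ?IH.
- by move=> P P' Q Q' _ IHP _ IHQ /andP[/IHP -> /IHQ ->].
- by move=> P P' Q Q' _ IHP _ IHQ _ /andP[/IHP -> /IHQ ->].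
Qed.

Lemma tick_closed_at i P P' k :
  tick i P P' -> closed_at k P -> closed_at k P'.
Proof.
move=> st; elim: st k => {P P'} //=; try by move=> *; auto.
- by move=> P P' _ IH k cP; apply: closed_at_inst => //; apply: IH.
- by move=> P P' Q Q' _ IHP _ IHQ k /andP[/IHP -> /IHQ ->].
- by move=> P P' Q Q' _ IHP _ IHQ _ k /andP[/IHP -> /IHQ ->].
Qed.

Lemma tick_process i P P' : tick i P P' -> process P -> process P'.
Proof.
move=> st /andP[wP cP].
by rewrite /process (tick_well_guarded st) ?(tick_closed_at st).
Qed.

(** Clock steps never remove an action prefix, so what protects an occurrence of a variable stays in
    place. *)
Lemma tick_guarded i P P' x : tick i P P' -> guarded x P -> guarded x P'.
Proof.
move=> st; elim: st x => {P P'} //=; try by move=> *; auto.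
- move=> P P' _ IH x gP; apply: guarded_subst => -[|n] /=; first by right.
  (* Instantiation turns index [n.+1] into [n], so only [n = x] can produce an occurrence of [x];
     there the induction hypothesis at [x.+1] applies. *)
  by case: (eqVneq n x) => [->|]; [left; apply: IH|right].
- by move=> P P' Q Q' _ IHP _ IHQ x /andP[/IHP -> /IHQ ->].
- by move=> P P' Q Q' _ IHP _ IHQ _ x /andP[/IHP -> /IHQ ->].
Qed.

Lemma tick_type1_type2 P P' : tick type1 P P' -> tick type2 P P'.
Proof. by elim=> {P P'} // *; by [constructor|apply: tick_skip]. Qed.

(** * Monotonicity of urgent sets *)

Lemma co_setS (U V : {fset act Lam}) : U `<=` V -> co_set U `<=` co_set V.
Proof.
move=> /fsubsetP sUV; apply/fsubsetP => _ /imfsetP[/= a aU ->].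
apply/imfsetP; exists a => //=.
move: aU; rewrite /= !mem_pmap => /mapP[b bU e].
by apply/mapP; exists b => //; apply: sUV.
Qed.

Lemma urgent_par P P' Q Q' :
  urgent P `<=` urgent P' -> urgent Q `<=` urgent Q' ->
  urgent (Par P Q) `<=` urgent (Par P' Q').
Proof.
move=> sP sQ /=; apply: fsetUSS; first exact: fsetUSS.
case: ifP => [/fset0Pn[a aPQ]|_]; last exact: fsub0set.
suff -> : urgent P' `&` co_set (urgent Q') != fset0 by [].
by apply/fset0Pn; exists a; apply: fsubsetP aPQ; apply: fsetISS (co_setS sQ).
Qed.

(** Variables contribute nothing and prefixes keep their action, so replacing variables can only add
    urgent actions. *)
Lemma urgent_subst P s : urgent P `<=` urgent (subst s P).
Proof.
elim: P s => //=.
- by move=> P IHP Q IHQ s; apply: fsetUSS.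
- by move=> P IHP Q IHQ s; apply: (urgent_par (IHP s) (IHQ s)).
- by move=> P IH L s; apply: fsetSD.
- by move=> P IH f s; apply: subset_imfset => a; apply: (fsubsetP (IH s)).
Qed.

(** * Transitions of substituted terms *)

Lemma step_subst P alpha P' s :
  step P alpha P' -> step (subst s P) alpha (subst s P').
Proof.
move=> st; elim: st s => {P alpha P'} /=; try by move=> *; econstructor; eauto.
by move=> alpha P P' _ IH s; rewrite subst_inst; apply: step_mu.
Qed.

(** This condition covers the unfolding of a guarded recursion, where the indices other than 0 are
    merely lowered, and it is stable under [up], which sends index 0 to a variable. It can therefore
    be carried through an induction that passes under [Mu]. *)
Definition var_or_guarded s P := forall x, guarded x P \/ exists y, s x = Var y.

Lemma var_or_guarded_up s P :
  var_or_guarded s (Mu P) -> var_or_guarded (up s) P.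
Proof.
move=> h [|n] /=; first by right; exists 0.
by case: (h n) => [|[y ->]]; [left|right; exists y.+1].
Qed.

Lemma var_or_guardedW s P Q R :
  (forall x, guarded x R -> guarded x P && guarded x Q) ->
  var_or_guarded s R -> var_or_guarded s P /\ var_or_guarded s Q.
Proof. by move=> h hR; split=> x; case: (hR x) => [/h/andP[]|]; auto. Qed.

(* Substituted occurrences cannot move: they are variables or action-guarded. *)
Lemma step_subst_inv P s alpha T :
  var_or_guarded s P -> step (subst s P) alpha T ->
  exists2 P', T = subst s P' & step P alpha P'.
Proof.
elim: P s alpha T => /=.
- by move=> s alpha T _ st; inversion st.
- move=> n s alpha T h st; case: (h n) => [/=|[y e]]; first by rewrite eqxx.
  by rewrite e in st; inversion st.
- move=> a P _ s alpha T _ st; inversion st; subst.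
  by exists P => //; constructor.
- move=> P IH s alpha T h st; inversion st as [|? ? ? sP| | | | | | | |]; subst.
  have [P' -> stP] := IH _ _ _ h sP.
  by exists P' => //; constructor.
- move=> P IHP Q IHQ s alpha T /var_or_guardedW /= /(_ P Q) [] // hP hQ.
  case/step_sum_inv => [/(IHP _ _ _ hP)|/(IHQ _ _ _ hQ)] [T' -> sT].
    by exists T' => //; apply: step_suml.
  by exists T' => //; apply: step_sumr.
- move=> P IHP Q IHQ s alpha T /var_or_guardedW /= /(_ P Q) [] // hP hQ.
  case/step_par_inv => [[P1 -> /(IHP _ _ _ hP)]|[Q1 -> /(IHQ _ _ _ hQ)]|].
  + by case=> P' -> sP; exists (Par P' Q) => //; apply: step_parl.
  + by case=> Q' -> sQ; exists (Par P Q') => //; apply: step_parr.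
  + case=> a [P1 [Q1 [-> -> /(IHP _ _ _ hP) [P' -> sP] /(IHQ _ _ _ hQ)]]].
    by case=> Q' -> sQ; exists (Par P' Q') => //; apply: step_com sP sQ.
- move=> P IH L s alpha T h /step_res_inv [aL [P1 -> /(IH _ _ _ h) [P' -> sP]]].
  by exists (Res P' L) => //; apply: step_res.
- move=> P IH f s alpha T h /step_rel_inv [b [P1 [-> -> /(IH _ _ _ h)]]].
  by case=> P' -> sP; exists (Rel P' f) => //; apply: step_rel.
- move=> P IH s alpha T /var_or_guarded_up h.
  case/step_mu_inv=> P1 -> /(IH _ _ _ h) [P' -> sP].
  by exists (inst P' (Mu P)); [rewrite subst_inst|apply: step_mu].
Qed.

(** A variable has no clock step, and a term substituted below an action prefix stays frozen there,
    so every clock step is already one of P. The side condition on parallel composition passes back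
    to P because substitution only enlarges urgent sets. *)
Lemma tick_subst_inv i P s T :
  var_or_guarded s P -> tick i (subst s P) T ->
  exists2 P', T = subst s P' & tick i P P'.
Proof.
elim: P s T => /=.
- by move=> s T _ st; inversion st; exists Nil => //; constructor.
- move=> n s T h st; case: (h n) => [/=|[y e]]; first by rewrite eqxx.
  by rewrite e in st; inversion st.
- move=> alpha P _ s T _ st; inversion st as [|a| | | | | | |]; subst.
  by exists (Pre (vis a) P) => //; constructor.
- move=> P IH s T h st; inversion st as [| | | | | | | |? ? ? sP]; subst.
    by exists P => //; constructor.
  have [P' -> stP] := IH _ _ h sP.
  by exists P' => //; apply: tick_skip.
- move=> P IHP Q IHQ s T /var_or_guardedW /= /(_ P Q) [] // hP hQ.
  case/tick_sum_inv=> P1 [Q1 [-> /(IHP _ _ hP) [P' -> sP] /(IHQ _ _ hQ)]].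
  by case=> Q' -> sQ; exists (Sum P' Q') => //; apply: tick_sum.
- move=> P IHP Q IHQ s T /var_or_guardedW /= /(_ P Q) [] // hP hQ.
  case/tick_par_inv=> P1 [Q1 [-> /(IHP _ _ hP) [P' -> sP] /(IHQ _ _ hQ)]].
  case=> Q' -> sQ nU; exists (Par P' Q') => //; apply: tick_par => //.
  by apply: contra nU; apply: (fsubsetP (urgent_subst (Par P Q) s)).
- move=> P IH L s T h /tick_res_inv [P1 -> /(IH _ _ h) [P' -> sP]].
  by exists (Res P' L) => //; apply: tick_res.
- move=> P IH f s T h /tick_rel_inv [P1 -> /(IH _ _ h) [P' -> sP]].
  by exists (Rel P' f) => //; apply: tick_rel.
- move=> P IH s T /var_or_guarded_up h.
  case/tick_mu_inv=> P1 -> /(IH _ _ h) [P' -> sP].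
  by exists (inst P' (Mu P)); [rewrite subst_inst|apply: tick_mu].
Qed.

Lemma var_or_guarded_inst P Q :
  guarded 0 P -> var_or_guarded (fun n => if n is m.+1 then Var m else Q) P.
Proof. by move=> g [|n]; [left|right; exists n]. Qed.

End Transitions.

(** * The relation of being ahead, and its interplay with transitions *)

Section Ahead.
Variable Lam : countType.

(** There is no congruence rule for action prefixes, since only leading clock prefixes may go. Below
    a recursion they can be removed only in the copy of the body exposed by one unfolding, so
    [ahead_mu] mirrors the rule [tick_mu]; its guardedness premise ensures that the unfolded term
    moves only as its body does. *)
Inductive ahead : term Lam -> term Lam -> Prop :=
| ahead_refl P : ahead P P
| ahead_trans Q P R : ahead P Q -> ahead Q R -> ahead P R
| ahead_clk P : ahead P (Clk P)
| ahead_sum P P' Q Q' : ahead P P' -> ahead Q Q' -> ahead (Sum P Q) (Sum P' Q')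
| ahead_par P P' Q Q' : ahead P P' -> ahead Q Q' -> ahead (Par P Q) (Par P' Q')
| ahead_res P P' L : ahead P P' -> ahead (Res P L) (Res P' L)
| ahead_rel P P' f : ahead P P' -> ahead (Rel P f) (Rel P' f)
| ahead_mu P P' :
    guarded 0 P -> ahead P P' -> ahead (inst P (Mu P')) (Mu P').

Implicit Types (P Q : term Lam) (s : nat -> term Lam) (alpha : act Lam).

Lemma ahead_subst P Q s : ahead P Q -> ahead (subst s P) (subst s Q).
Proof.
move=> a; elim: a s => {P Q} /=; try by move=> *; econstructor; eauto.
move=> P P' g _ IH s; rewrite subst_inst /=.
by apply: ahead_mu => //; apply: guarded0_up.
Qed.

(** In [ahead_tick], this supplies well-guardedness of the intermediate term of a chain. *)
Lemma ahead_well_guarded P Q : ahead P Q -> well_guarded Q -> well_guarded P.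
Proof.
elim=> {P Q} //=.
- by move=> Q P R _ IHP _ IHQ /IHQ /IHP.
- by move=> P P' Q Q' _ IHP _ IHQ /andP[/IHP -> /IHQ ->].
- by move=> P P' Q Q' _ IHP _ IHQ /andP[/IHP -> /IHQ ->].
- move=> P P' _ _ IH /andP[g w].
  by apply: well_guarded_inst; rewrite /= ?g ?IH.
Qed.

Lemma ahead_urgent P Q : ahead P Q -> urgent Q `<=` urgent P.
Proof.
elim=> {P Q} //=.
- by move=> Q P R _ sP _ sQ; apply: fsubset_trans sQ sP.
- by move=> P P' Q Q' _ sP _ sQ; apply: fsetUSS.
- by move=> P P' Q Q' _ sP _ sQ; apply: (urgent_par sP sQ).
- by move=> P P' L _ sP; apply: fsetSD.
- by move=> P P' f _ sP; apply: subset_imfset => a; apply: (fsubsetP sP).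
- by move=> P P' _ _ sP; apply: fsubset_trans sP _; apply: urgent_subst.
Qed.

(** The rules of [tick] match those of [ahead] one by one, [tick_skip] by transitivity.
    Well-guardedness, kept along the step by [tick_guarded], provides the premise of [ahead_mu]. *)
Lemma tick_ahead i P P' : well_guarded P -> tick i P P' -> ahead P' P.
Proof.
move=> w st; elim: st w => {P P'} /=; try by move=> *; constructor; auto.
- move=> P P' st IH /andP[g w]; apply: ahead_mu; last exact: IH.
  exact: tick_guarded st g.
- by move=> P P' Q Q' _ IHP _ IHQ /andP[/IHP aP /IHQ aQ]; apply: ahead_sum.
- by move=> P P' Q Q' _ IHP _ IHQ _ /andP[/IHP aP /IHQ aQ]; apply: ahead_par.
- by move=> P P' _ _ IH /IH a; apply: ahead_trans a (ahead_clk P).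
Qed.

(** The type-1 step is found by replaying the derivation with every use of [tick_skip] replaced by
    [tick_clk]. The side condition on parallel composition concerns only the source and is inherited
    unchanged. *)
Lemma tick_type2_type1 P P' :
  well_guarded P -> tick type2 P P' ->
  exists2 P1, tick type1 P P1 & ahead P' P1.
Proof.
move=> w st; elim: st w => {P P'} /=.
- by exists Nil; constructor.
- by move=> a P _; exists (Pre (vis a) P); constructor.
- by move=> P _; exists P; constructor.
- move=> P P' _ IH /andP[_ /IH [P1 st a]].
  by exists (inst P1 (Mu P)); [apply: tick_mu|apply: ahead_subst].
- move=> P P' L _ IH /IH [P1 st a].
  by exists (Res P1 L); constructor.
- move=> P P' f _ IH /IH [P1 st a].
  by exists (Rel P1 f); constructor.
- move=> P P' Q Q' _ IHP _ IHQ /andP[/IHP [P1 sP aP] /IHQ [Q1 sQ aQ]].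
  by exists (Sum P1 Q1); constructor.
- move=> P P' Q Q' _ IHP _ IHQ h /andP[/IHP [P1 sP aP] /IHQ [Q1 sQ aQ]].
  by exists (Par P1 Q1); constructor.
- move=> P P' _ st _ w; exists P; first exact: tick_clk.
  exact: tick_ahead w st.
Qed.

Lemma ahead_step P Q alpha P' :
  ahead P Q -> step P alpha P' -> exists2 Q', step Q alpha Q' & ahead P' Q'.
Proof.
move=> a; elim: a alpha P' => {P Q} /=.
- by move=> P alpha P' st; exists P' => //; apply: ahead_refl.
- move=> Q P R _ IHP _ IHQ alpha P' /IHP [Q' /IHQ [R' st aQ] aP].
  by exists R' => //; apply: ahead_trans aP aQ.
- move=> P alpha P' st; exists P'; last exact: ahead_refl.
  exact: step_clk.
- move=> P P' Q Q' _ IHP _ IHQ alpha T.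
  case/step_sum_inv => [/IHP|/IHQ] [T' sT aT]; exists T' => //.
    exact: step_suml.
  exact: step_sumr.
- move=> P P' Q Q' aP IHP aQ IHQ alpha T.
  case/step_par_inv => [[P1 -> /IHP]|[Q1 -> /IHQ]|].
  + by case=> P2 s2 a2; exists (Par P2 Q'); [apply: step_parl|apply: ahead_par].
  + by case=> Q2 s2 a2; exists (Par P' Q2); [apply: step_parr|apply: ahead_par].
  + case=> a [P1 [Q1 [-> -> /IHP [P2 sP aP2] /IHQ [Q2 sQ aQ2]]]].
    by exists (Par P2 Q2); [apply: step_com sP sQ|apply: ahead_par].
- move=> P P' L _ IH alpha T /step_res_inv [aL [P1 -> /IH [P2 s2 a2]]].
  by exists (Res P2 L); constructor.
- move=> P P' f _ IH alpha T /step_rel_inv [b [P1 [-> -> /IH [P2 s2 a2]]]].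
  by exists (Rel P2 f); constructor.
(* By guardedness the unfolded copies of [Mu P'] cannot move, so the step comes from the body P and
   the induction hypothesis applies to it. *)
- move=> P P' g _ IH alpha T st.
  have [P1 -> /IH [P2 s2 a2]] :=
    step_subst_inv (var_or_guarded_inst (Mu P') g) st.
  by exists (inst P2 (Mu P')); [apply: step_mu|apply: ahead_subst].
Qed.

Lemma ahead_step_inv P Q alpha Q' :
  ahead P Q -> step Q alpha Q' -> exists2 P', step P alpha P' & ahead P' Q'.
Proof.
move=> a; elim: a alpha Q' => {P Q} /=.
- by move=> P alpha P' st; exists P' => //; apply: ahead_refl.
- move=> Q P R _ IHP _ IHQ alpha R' /IHQ [Q' /IHP [P' st aP] aQ].
  by exists P' => //; apply: ahead_trans aP aQ.
- move=> P alpha P' st; inversion st; subst.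
  by exists P' => //; apply: ahead_refl.
- move=> P P' Q Q' _ IHP _ IHQ alpha T.
  case/step_sum_inv => [/IHP|/IHQ] [T' sT aT]; exists T' => //.
    exact: step_suml.
  exact: step_sumr.
- move=> P P' Q Q' aP IHP aQ IHQ alpha T.
  case/step_par_inv => [[P1 -> /IHP]|[Q1 -> /IHQ]|].
  + by case=> P2 s2 a2; exists (Par P2 Q); [apply: step_parl|apply: ahead_par].
  + by case=> Q2 s2 a2; exists (Par P Q2); [apply: step_parr|apply: ahead_par].
  + case=> a [P1 [Q1 [-> -> /IHP [P2 sP aP2] /IHQ [Q2 sQ aQ2]]]].
    by exists (Par P2 Q2); [apply: step_com sP sQ|apply: ahead_par].
- move=> P P' L _ IH alpha T /step_res_inv [aL [P1 -> /IH [P2 s2 a2]]].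
  by exists (Res P2 L); constructor.
- move=> P P' f _ IH alpha T /step_rel_inv [b [P1 [-> -> /IH [P2 s2 a2]]]].
  by exists (Rel P2 f); constructor.
- move=> P P' g _ IH alpha T /step_mu_inv [P1 -> /IH [P2 s2 a2]].
  by exists (inst P2 (Mu P')); [apply: step_subst|apply: ahead_subst].
Qed.

(** A removed clock prefix is answered by [tick_clk]: [Clk P] reaches P, and [P'] is ahead of P
    because a clock step led there. Under parallel composition the slower side may tick too, its
    urgent set being the smaller one. *)
Lemma ahead_tick i P Q P' :
  well_guarded Q -> ahead P Q -> tick i P P' ->
  exists2 Q', tick i Q Q' & ahead P' Q'.
Proof.
move=> w a; elim: a w P' => {P Q} /=.
- by move=> P _ P' st; exists P' => //; apply: ahead_refl.
- move=> Q P R _ IHP aQ IHQ w P' st.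
  have [Q' sQ aP'] := IHP (ahead_well_guarded aQ w) _ st.
  have [R' sR aQ'] := IHQ w _ sQ.
  by exists R' => //; apply: ahead_trans aP' aQ'.
- by move=> P w P' st; exists P; [apply: tick_clk|apply: tick_ahead st].
- move=> P P' Q Q' _ IHP _ IHQ /andP[wP wQ] T.
  case/tick_sum_inv=> P1 [Q1 [-> /(IHP wP) [P2 sP aP] /(IHQ wQ) [Q2 sQ aQ]]].
  by exists (Sum P2 Q2); constructor.
- move=> P P' Q Q' aP IHP aQ IHQ /andP[wP wQ] T /tick_par_inv.
  case=> P1 [Q1 [-> /(IHP wP) [P2 sP aP2] /(IHQ wQ) [Q2 sQ aQ2] nU]].
  exists (Par P2 Q2); constructor => //.
  by apply: contra nU; apply: (fsubsetP (ahead_urgent (ahead_par aP aQ))).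
- move=> P P' L _ IH w T /tick_res_inv [P1 -> /(IH w) [P2 s2 a2]].
  by exists (Res P2 L); constructor.
- move=> P P' f _ IH w T /tick_rel_inv [P1 -> /(IH w) [P2 s2 a2]].
  by exists (Rel P2 f); constructor.
- move=> P P' g _ IH /andP[_ w] T st.
  have [P1 -> /(IH w) [P2 s2 a2]] :=
    tick_subst_inv (var_or_guarded_inst (Mu P') g) st.
  by exists (inst P2 (Mu P')); [apply: tick_mu|apply: ahead_subst].
Qed.

End Ahead.

(** * The faster-than preorders *)

Section FasterThan.
Variable Lam : countType.
Implicit Types (i : clock_type) (P Q : term Lam).

Lemma faster_than_process i P Q : faster_than i P Q -> process P /\ process Q.
Proof. by case=> R [h _] /h. Qed.

Lemma faster_than_step i P Q alpha P' :
  faster_than i P Q -> step P alpha P' ->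
  exists2 Q', step Q alpha Q' & faster_than i P' Q'.
Proof.
case=> R hR /(hR.2) [h _ _] /h [Q' st r].
by exists Q' => //; exists R.
Qed.

Lemma faster_than_step_inv i P Q alpha Q' :
  faster_than i P Q -> step Q alpha Q' ->
  exists2 P', step P alpha P' & faster_than i P' Q'.
Proof.
case=> R hR /(hR.2) [_ h _] /h [P' st r].
by exists P' => //; exists R.
Qed.

Lemma faster_than_tick i P Q P' :
  faster_than i P Q -> tick i P P' ->
  urgent Q `<=` urgent P /\ exists2 Q', tick i Q Q' & faster_than i P' Q'.
Proof.
case=> R hR /(hR.2) [_ _ h] /h [sU [Q' st r]].
by split=> //; exists Q' => //; exists R.
Qed.

Lemma faster_than_trans i P Q S :
  faster_than i P Q -> faster_than i Q S -> faster_than i P S.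
Proof.
move=> fPQ fQS.
(* [faster_than i] satisfies its own simulation clauses, so its composition with itself serves as
   the witness. *)
exists (fun A C => exists2 B, faster_than i A B & faster_than i B C);
  last by exists Q.
split=> [A C [B /faster_than_process[pA _] /faster_than_process[_ pC]] //|].
move=> {P Q S fPQ fQS} A C [B fAB fBC]; split.
- move=> alpha A' /(faster_than_step fAB).
  case=> [B' /(faster_than_step fBC) [C' sC fC] fB].
  by exists C' => //; exists B'.
- move=> alpha C' /(faster_than_step_inv fBC) [B' sB fB].
  have [A' sA fA] := faster_than_step_inv fAB sB.
  by exists A' => //; exists B'.
- move=> A' /(faster_than_tick fAB) [uAB [B' sB fB]].
  have [uBC [C' sC fC]] := faster_than_tick fBC sB.
  split; first exact: fsubset_trans uBC uAB.
  by exists C' => //; exists B'.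
Qed.

Lemma ahead_faster_than i P Q :
  process P -> process Q -> ahead P Q -> faster_than i P Q.
Proof.
move=> pP pQ aPQ.
exists (fun A B => [/\ process A, process B & ahead A B]) => //.
split=> [A B [] //|] {P Q pP pQ aPQ} A B [pA pB aAB]; split.
- move=> alpha A' sA; have [B' sB aB] := ahead_step aAB sA.
  by exists B' => //; split=> //; apply: step_process; eassumption.
- move=> alpha B' sB; have [A' sA aA] := ahead_step_inv aAB sB.
  by exists A' => //; split=> //; apply: step_process; eassumption.
- move=> A' sA; split; first exact: ahead_urgent.
  have [B' sB aB] := ahead_tick (andP pB).1 aAB sA.
  by exists B' => //; split=> //; apply: tick_process; eassumption.
Qed.

(** The action clauses do not mention the clock type, so [faster_than i] becomes a j-faster-than
    relation as soon as its clock clause holds for j. *)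
Lemma faster_than_switch i j P Q :
  (forall A A' B : term Lam, faster_than i A B -> tick j A A' ->
     urgent B `<=` urgent A /\ exists2 B', tick j B B' & faster_than i A' B') ->
  faster_than i P Q -> faster_than j P Q.
Proof.
move=> h f; exists (faster_than i) => //.
split=> [A B|{P Q f} A B f]; first exact: faster_than_process.
split=> [alpha A'|alpha B'|A']; last exact: h.
- exact: faster_than_step.
- exact: faster_than_step_inv.
Qed.

End FasterThan.

Theorem theorem17 (Lam : countType) (P Q : term Lam)
    (hP : process P) (hQ : process Q) :
  faster_than type1 P Q <-> faster_than type2 P Q.
Proof.
split; apply: faster_than_switch => {P Q hP hQ} A A' B f sA;
  have [pA pB] := faster_than_process f.
(* The type-2 step to [A'] is retracted to the type-1 step to [A1], which B matches by [B1]; then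
   [A'] is faster than [A1], hence than [B1]. *)
- have [A1 sA1 aA1] := tick_type2_type1 (andP pA).1 sA.
  have [sU [B1 sB1 fB1]] := faster_than_tick f sA1.
  split=> //; exists B1; first exact: tick_type1_type2.
  apply: faster_than_trans fB1; apply: ahead_faster_than => //.
    exact: tick_process sA pA.
  exact: tick_process sA1 pA.
(* Here it is the answer of B that may be too advanced: the type-2 target [B'] is replaced by the
   type-1 target [B1], which is slower than [B'] and hence than [A']. *)
- have [sU [B' sB fB]] := faster_than_tick f (tick_type1_type2 sA).
  have [B1 sB1 aB1] := tick_type2_type1 (andP pB).1 sB.
  split=> //; exists B1 => //.
  apply: faster_than_trans fB _; apply: ahead_faster_than => //.
    exact: tick_process sB pB.
  exact: tick_process sB1 pB.
Qed.
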